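(* For all large enough $n$, we have $$\frac{n}{18(\log n-\log 18+2)}-6\leq G(3,2,n)\leq\frac{1}{18}n^2+\frac{7}{6}n.$$
   Context: $S_n$ denotes the set of permutations of $\{1,2,\ldots,n\}$ written in one-line notation $p=(p_1,p_2,\ldots,p_n)$. A subsequence of $p$ of length $k$ is a sequence $(p_{i_1},\ldots,p_{i_k})$ with $i_1<\cdots<i_k$. A sequence is monotone if it is increasing or decreasing. A sequence $(a_1,a_2,\ldots,a_k)$ of positive integers is $\ell$-additive if $a_1+a_2+\cdots+a_k=\ell a_1$ or $a_1+a_2+\cdots+a_k=\ell a_k$. For positive integers $k,\ell,n$ and $p\in S_n$, $G_p(k,\ell,n)$ is the number of monotone $\ell$-additive subsequences of length $k$ in $p$, and $G(k,\ell,n)=\min_{p\in S_n}G_p(k,\ell,n)$. Here $\log$ is the natural logarithm. *)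

(* Defs.v *)
From mathcomp Require Import all_boot all_fingroup.

Set Implicit Arguments.
Unset Strict Implicit.
Unset Printing Implicit Defensive.

Definition monotone_seq (s : seq nat) : bool := sorted ltn s || sorted gtn s.

(* The default value 0 of [head] and [last] only matters for the empty
   sequence, which does not occur since the length k is positive. *)
Definition additive_seq (l : nat) (s : seq nat) : bool :=
  (sumn s == l * head 0 s) || (sumn s == l * last 0 s).

(* 'S_n permutes {0, ..., n-1}; the successor below shifts the values of p to
   the one-line notation on {1, ..., n}. *)
Definition subseq_at (n k : nat) (p : 'S_n) (t : k.-tuple 'I_n) : seq nat :=
  [seq (val (p i)).+1 | i <- t].

(* Since p is injective, distinct position tuples i_1 < ... < i_k yield
   distinct subsequences, so subsequences are counted by their positions. *)
Definition Gp (k l n : nat) (p : 'S_n) : nat :=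
  #|[set t : k.-tuple 'I_n |
      [&& sorted ltn [seq val i | i <- t],
          monotone_seq (subseq_at p t)
        & additive_seq l (subseq_at p t)]]|.

Definition G (k l n : nat) : nat :=
  Gp k l [arg min_(p < (1%g : 'S_n)) Gp k l p].

(* Main.v *)
Require Import Defs.
From mathcomp Require Import all_boot all_order all_fingroup all_algebra.
From mathcomp Require Import zify lra.
From mathcomp Require Import reals exp.

Set Implicit Arguments.
Unset Strict Implicit.
Unset Printing Implicit Defensive.

(** A monotone 2-additive subsequence of length 3 is a triple of values
    x < y < x + y in which y stands between x and x + y; both bounds count such
    triples.

    Upper bound. With m = n / 3, the permutation m, ..., 1, n, ..., m + 1
    consists of two decreasing blocks with every value of the first below every
    value of the second. It has no increasing subsequence of length 3, and a
    decreasing one lies inside a single block. So the triples that count are the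
    pairs x < y with x + y <= m, and the pairs x < y with m < x and x + y <= n.
    Each kind has about (n / 3)^2 / 4 members ([size_schur_pairs]), which makes
    n^2 / 18 in total ([G32_le]).

    Lower bound. Every ordering of 1, ..., 18 contains such a triple
    ([ex_between18]). Applied to d, 2d, ..., 18d this gives a triple for each
    d <= n / 18, with x + y = k d for some k < 19. The triple and k determine d,
    so there are at least (n / 18) / 19 triples ([G32_ge]). This bound is linear in n, hence it exceeds the stated one as
    soon as log n - log 18 + 2 >= 19. *)

Definition schur_triple (a b c : nat) : bool := [&& a < b, b < c & c == a + b].

(** Positivity excludes the other two cases: the first and the last entry are
    the extremes of a monotone triple, and twice the smaller is less than the
    sum. *)
Lemma monotone_additive3E a b c : 0 < a -> 0 < b -> 0 < c ->
  monotone_seq [:: a; b; c] && additive_seq 2 [:: a; b; c] =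
  schur_triple a b c || schur_triple c b a.
Proof.
rewrite /monotone_seq /additive_seq /schur_triple /= => a_gt0 b_gt0 c_gt0.
by lia.
Qed.

Definition additive_triples n (p : 'S_n) : {set 3.-tuple 'I_n} :=
  [set t : 3.-tuple 'I_n |
      [&& sorted ltn [seq val i | i <- t],
          monotone_seq (subseq_at p t)
        & additive_seq 2 (subseq_at p t)]].

Lemma mem_additive_triples n (p : 'S_n) (i j k : 'I_n) :
  ([tuple i; j; k] \in additive_triples p) =
  [&& i < j, j < k & schur_triple (p i).+1 (p j).+1 (p k).+1
                     || schur_triple (p k).+1 (p j).+1 (p i).+1].
Proof.
by rewrite inE -monotone_additive3E //= andbT -andbA.
Qed.

Lemma tuple3P (T : Type) (t : 3.-tuple T) :
  exists i j k, t = [tuple i; j; k].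
Proof.
case: t => -[|i [|j [|k []]]] // size_t.
by exists i, j, k; apply: val_inj.
Qed.

(** * Upper bound *)

(** Positions and values count from 0 here. The map exchanges the positions
    inside each block, so it is an involution; the default of [insubd] is never
    reached when m <= n. *)
Definition two_block_fun m n (i : 'I_n) : 'I_n :=
  insubd i (if i < m then m.-1 - i else (n + m).-1 - i).

Lemma val_two_block_fun m n (i : 'I_n) : m <= n ->
  two_block_fun m i = (if i < m then m.-1 - i else (n + m).-1 - i) :> nat.
Proof.
move=> le_mn; rewrite val_insubd ifT //.
by have := ltn_ord i; case: ifP; lia.
Qed.

Lemma two_block_fun_inj m n : m <= n -> injective (@two_block_fun m n).
Proof.
move=> le_mn; apply: (can_inj (g := @two_block_fun m n)) => i.
apply: val_inj; rewrite /= !val_two_block_fun //.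
by have := ltn_ord i; case: (ltnP i m) => ?; case: ifP; lia.
Qed.

Definition two_block m n (le_mn : m <= n) : 'S_n :=
  perm (two_block_fun_inj le_mn).

(** The summands of the triples c < b < b + c with values between lo and r. A
    list rather than a set, so that its size is a plain sum over c. *)
Definition schur_pairs lo r : seq (nat * nat) :=
  [seq (c, b) | c <- iota lo (r - lo), b <- iota c.+1 (r - c.*2)].

Lemma mem_schur_pairs lo r c b :
  lo <= c -> c < b -> b + c <= r -> (c, b) \in schur_pairs lo r.
Proof.
move=> le_lo lt_cb le_r; apply/allpairsPdep; exists c, b.
by rewrite !mem_iota; split=> //; lia.
Qed.

(** With e = r + 1 - 2 lo, the summand lo contributes e - 1 pairs and the larger
    ones form the same problem for e - 2, so the bound is the induction
    4 (e - 1) + (e - 2)^2 = e^2. *)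
Lemma size_schur_pairs lo r :
  4 * size (schur_pairs lo r) <= (r.+1 - lo.*2) ^ 2.
Proof.
rewrite /schur_pairs size_allpairs_dep.
under eq_map => c do rewrite size_iota.
(* The length r - lo of the outer list is immaterial for the bound. *)
move: (r - lo) => k; elim: k lo => [|k IHk] lo //=.
have := IHk lo.+1; set s := sumn _.
rewrite doubleS !expnS !expn0 !muln1.
have [le_r|lt_r] := leqP lo.*2.+1 r; last by nia.
have -> : r.+1 - lo.*2 = (r.+1 - lo.*2.+2) + 2 by lia.
have -> : r - lo.*2 = (r.+1 - lo.*2.+2) + 1 by lia.
by nia.
Qed.

(** Inside a block the permutation decreases and from the first block to the
    second it increases. So three positions with monotone values cannot meet
    both blocks, and their values decrease. *)
Lemma two_block_triple m n (le_mn : m <= n) (i j k : 'I_n) :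
  let p := two_block le_mn in
  [tuple i; j; k] \in additive_triples p ->
  (p i).+1 = (p j).+1 + (p k).+1 /\
  ((p k).+1, (p j).+1) \in schur_pairs 1 m ++ schur_pairs m.+1 n.
Proof.
move=> p; rewrite mem_additive_triples mem_cat !permE !val_two_block_fun //.
case/and3P=> lt_ij lt_jk.
rewrite /schur_triple; have := ltn_ord k.
case: (ltnP i m) (ltnP j m) (ltnP k m) => ? [] ? [] ? lt_kn tr; split; try lia.
all: apply/orP.
all: by [ left; apply: mem_schur_pairs; lia
        | right; apply: mem_schur_pairs; lia ].
Qed.

(** A triple is recovered from its two smaller values, the largest being their
    sum. *)
Lemma card_two_block m n (le_mn : m <= n) :
  4 * #|additive_triples (two_block le_mn)| <=
  m.-1 ^ 2 + (n.-1 - m.*2) ^ 2.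
Proof.
set p := two_block le_mn; set A := additive_triples p.
pose key (t : 3.-tuple 'I_n) :=
  let s := subseq_at p t in (nth 0 s 2, nth 0 s 1).
have key_inj : {in A &, injective key}.
  move=> t t'; have [i [j [k ->]]] := tuple3P t.
  have [i' [j' [k' ->]]] := tuple3P t'.
  move=> /two_block_triple[Di _] /two_block_triple[Di' _] [Dk Dj].
  have Dpi : p i = p i' :> nat.
    by apply: succn_inj; rewrite [LHS]Di [RHS]Di' Dj Dk.
  by congr [tuple _; _; _]; apply: (@perm_inj _ p); apply: val_inj.
have uniq_keys : uniq [seq key t | t <- enum A].
  rewrite map_inj_in_uniq ?enum_uniq // => t t'.
  by rewrite !mem_enum; apply: key_inj.
have : {subset [seq key t | t <- enum A]
        <= schur_pairs 1 m ++ schur_pairs m.+1 n}.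
  move=> _ /mapP[t + ->]; rewrite mem_enum; have [i [j [k ->]]] := tuple3P t.
  by case/two_block_triple.
move/(uniq_leq_size uniq_keys); rewrite size_map -cardE size_cat.
have := size_schur_pairs 1 m; have := size_schur_pairs m.+1 n.
have -> : n.+1 - m.+1.*2 = n.-1 - m.*2 by lia.
have -> : m.+1 - 1.*2 = m.-1 by lia.
move=> le_hi le_lo le_card; apply: leq_trans (leq_add le_lo le_hi).
by rewrite -mulnDr leq_mul2l.
Qed.

Lemma G32_le n : 4 * G 3 2 n <= 2 * (n %/ 3) ^ 2 + 2.
Proof.
have le_mn : n %/ 3 <= n by exact: leq_div.
have le_G : G 3 2 n <= #|additive_triples (two_block le_mn)|.
  by rewrite /G; case: arg_minnP => // q _; apply.
have := card_two_block le_mn; have := leq_divM n 3.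
have := divn_eq n 3; have := ltn_pmod n (isT : 0 < 3).
move: le_G; set g := G _ _ _; set m := n %/ 3; set e := n %% 3.
set A := #|_| => le_G lt_e Dn _.
(* Both blocks are balanced up to 1: if n = 3 m + e then the second square has
   base m + e - 1 <= m + 1. *)
have le2 : n.-1 - m.*2 <= m.+1 by lia.
have le1 : m.-1 ^ 2 + (n.-1 - m.*2) ^ 2 <= m.-1 ^ 2 + m.+1 ^ 2.
  by rewrite leq_add2l leq_sqr.
rewrite !expnS !expn0 !muln1 in le1 *.
by nia.
Qed.

(** * Lower bound *)

(** If y never stands between x and x + y, then x and x + y are always on the
    same side of y. So for x < y a comparison of x with y gives the one of x + y
    with y ([sum_lo], [sum_hi]), and conversely ([part_lo], [part_hi]). Together
    with transitivity these rules refute r 1 2 after case distinctions on the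
    pairs (1, 7) and (3, 4); each refutation ends with two opposite
    comparisons. *)
Lemma between_free18 (r : rel nat) :
    irreflexive r -> transitive r ->
    (forall u v, 0 < u <= 18 -> 0 < v <= 18 -> u != v -> r u v || r v u) ->
    (forall x y, 0 < x < y -> x + y <= 18 ->
       ~~ (r x y && r y (x + y)) && ~~ (r (x + y) y && r y x)) ->
  ~~ r 1 2.
Proof.
move=> r_irr r_tr r_tot r_free; apply/negP=> r1_2.
have r_trans u v w : r u v -> r v w -> r u w by exact: r_tr.
have r_asym u v : r u v -> r v u -> False.
  by move=> ruv rvu; have := r_trans _ _ _ ruv rvu; rewrite r_irr.
have sum_lo x y : 0 < x < y -> x + y <= 18 -> r x y -> r (x + y) y.
  move=> xy le18 rxy; have /andP[+ _] := r_free x y xy le18.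
  by have := r_tot (x + y) y; rewrite rxy; lia.
have sum_hi x y : 0 < x < y -> x + y <= 18 -> r y x -> r y (x + y).
  move=> xy le18 ryx; have /andP[_] := r_free x y xy le18.
  by have := r_tot (x + y) y; rewrite ryx andbT; lia.
have part_lo x y : 0 < x < y -> x + y <= 18 -> r (x + y) y -> r x y.
  move=> xy le18 rzy; have := r_tot x y.
  by case ryx: (r y x); [case: (r_asym _ _ rzy (sum_hi _ _ xy le18 ryx))|lia].
have part_hi x y : 0 < x < y -> x + y <= 18 -> r y (x + y) -> r y x.
  move=> xy le18 ryz; have := r_tot x y.
  by case rxy: (r x y); [case: (r_asym _ _ ryz (sum_lo _ _ xy le18 rxy))|lia].
(* Along the Fibonacci numbers the direction alternates. *)
have r3_2 : r 3 2 := sum_lo 1 2 isT isT r1_2.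
have r3_5 : r 3 5 := sum_hi 2 3 isT isT r3_2.
have r8_5 : r 8 5 := sum_lo 3 5 isT isT r3_5.
have r8_13 : r 8 13 := sum_hi 5 8 isT isT r8_5.
have [r1_7|r7_1] := orP (r_tot 1 7 isT isT isT); last first.
  have r7_8 : r 7 8 := sum_hi 1 7 isT isT r7_1.
  have r7_13 : r 7 13 := r_trans _ _ _ r7_8 r8_13.
  have r7_6 : r 7 6 := part_hi 6 7 isT isT r7_13.
  have r7_5 : r 7 5 := r_trans _ _ _ r7_8 r8_5.
  have r2_5 : r 2 5 := part_lo 2 5 isT isT r7_5.
  have r1_5 : r 1 5 := r_trans _ _ _ r1_2 r2_5.
  have r6_5 : r 6 5 := sum_lo 1 5 isT isT r1_5.
  have r6_11 : r 6 11 := sum_hi 5 6 isT isT r6_5.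
  have r7_11 : r 7 11 := r_trans _ _ _ r7_6 r6_11.
  have r7_4 : r 7 4 := part_hi 4 7 isT isT r7_11.
  have r3_4 : r 3 4 := part_lo 3 4 isT isT r7_4.
  have r3_1 : r 3 1 := part_hi 1 3 isT isT r3_4.
  have r1_6 : r 1 6 := part_lo 1 6 isT isT r7_6.
  have r3_6 : r 3 6 := r_trans _ _ _ r3_1 r1_6.
  have r9_6 : r 9 6 := sum_lo 3 6 isT isT r3_6.
  have r9_15 : r 9 15 := sum_hi 6 9 isT isT r9_6.
  have r15_8 : r 15 8 := sum_lo 7 8 isT isT r7_8.
  have r9_8 : r 9 8 := r_trans _ _ _ r9_15 r15_8.
  have r1_8 : r 1 8 := part_lo 1 8 isT isT r9_8.
  have r3_8 : r 3 8 := r_trans _ _ _ r3_1 r1_8.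
  have r11_8 : r 11 8 := sum_lo 3 8 isT isT r3_8.
  have r7_2 : r 7 2 := r_trans _ _ _ r7_1 r1_2.
  have r7_9 : r 7 9 := sum_hi 2 7 isT isT r7_2.
  have r16_9 : r 16 9 := sum_lo 7 9 isT isT r7_9.
  have r9_11 : r 9 11 := r_trans _ _ _ r9_6 r6_11.
  have r16_11 : r 16 11 := r_trans _ _ _ r16_9 r9_11.
  have r5_11 : r 5 11 := part_lo 5 11 isT isT r16_11.
  have r8_11 : r 8 11 := r_trans _ _ _ r8_5 r5_11.
  exact: (r_asym _ _ r8_11 r11_8).
have [r3_4|r4_3] := orP (r_tot 3 4 isT isT isT).
  have r8_7 : r 8 7 := sum_lo 1 7 isT isT r1_7.
  have r7_4 : r 7 4 := sum_lo 3 4 isT isT r3_4.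
  have r7_11 : r 7 11 := sum_hi 4 7 isT isT r7_4.
  have r8_11 : r 8 11 := r_trans _ _ _ r8_7 r7_11.
  have r8_3 : r 8 3 := part_hi 3 8 isT isT r8_11.
  have r8_2 : r 8 2 := r_trans _ _ _ r8_3 r3_2.
  have r8_10 : r 8 10 := sum_hi 2 8 isT isT r8_2.
  have r3_1 : r 3 1 := part_hi 1 3 isT isT r3_4.
  have r3_7 : r 3 7 := r_trans _ _ _ r3_1 r1_7.
  have r10_7 : r 10 7 := sum_lo 3 7 isT isT r3_7.
  have r10_4 : r 10 4 := r_trans _ _ _ r10_7 r7_4.
  have r10_14 : r 10 14 := sum_hi 4 10 isT isT r10_4.
  have r8_14 : r 8 14 := r_trans _ _ _ r8_10 r10_14.
  have r8_6 : r 8 6 := part_hi 6 8 isT isT r8_14.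
  have r2_6 : r 2 6 := part_lo 2 6 isT isT r8_6.
  have r3_6 : r 3 6 := r_trans _ _ _ r3_2 r2_6.
  have r9_6 : r 9 6 := sum_lo 3 6 isT isT r3_6.
  have r18_10 : r 18 10 := sum_lo 8 10 isT isT r8_10.
  have r10_11 : r 10 11 := r_trans _ _ _ r10_7 r7_11.
  have r10_1 : r 10 1 := part_hi 1 10 isT isT r10_11.
  have r10_2 : r 10 2 := r_trans _ _ _ r10_1 r1_2.
  have r10_12 : r 10 12 := sum_hi 2 10 isT isT r10_2.
  have r18_12 : r 18 12 := r_trans _ _ _ r18_10 r10_12.
  have r6_12 : r 6 12 := part_lo 6 12 isT isT r18_12.
  have r1_4 : r 1 4 := r_trans _ _ _ r1_7 r7_4.
  have r5_4 : r 5 4 := sum_lo 1 4 isT isT r1_4.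
  have r5_9 : r 5 9 := sum_hi 4 5 isT isT r5_4.
  have r3_9 : r 3 9 := r_trans _ _ _ r3_5 r5_9.
  have r12_9 : r 12 9 := sum_lo 3 9 isT isT r3_9.
  have r6_9 : r 6 9 := r_trans _ _ _ r6_12 r12_9.
  exact: (r_asym _ _ r6_9 r9_6).
have r8_7 : r 8 7 := sum_lo 1 7 isT isT r1_7.
have r8_15 : r 8 15 := sum_hi 7 8 isT isT r8_7.
have r4_2 : r 4 2 := r_trans _ _ _ r4_3 r3_2.
have r4_6 : r 4 6 := sum_hi 2 4 isT isT r4_2.
have r1_3 : r 1 3 := part_lo 1 3 isT isT r4_3.
have r1_5 : r 1 5 := r_trans _ _ _ r1_3 r3_5.
have r6_5 : r 6 5 := sum_lo 1 5 isT isT r1_5.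
have r6_11 : r 6 11 := sum_hi 5 6 isT isT r6_5.
have r4_11 : r 4 11 := r_trans _ _ _ r4_6 r6_11.
have r15_11 : r 15 11 := sum_lo 4 11 isT isT r4_11.
have r8_11 : r 8 11 := r_trans _ _ _ r8_15 r15_11.
have r8_3 : r 8 3 := part_hi 3 8 isT isT r8_11.
have r8_2 : r 8 2 := r_trans _ _ _ r8_3 r3_2.
have r10_6 : r 10 6 := sum_lo 4 6 isT isT r4_6.
have r10_11 : r 10 11 := r_trans _ _ _ r10_6 r6_11.
have r4_7 : r 4 7 := sum_hi 3 4 isT isT r4_3.
have r11_7 : r 11 7 := sum_lo 4 7 isT isT r4_7.
have r11_18 : r 11 18 := sum_hi 7 11 isT isT r11_7.
have r10_18 : r 10 18 := r_trans _ _ _ r10_11 r11_18.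
have r10_8 : r 10 8 := part_hi 8 10 isT isT r10_18.
have r2_8 : r 2 8 := part_lo 2 8 isT isT r10_8.
exact: (r_asym _ _ r2_8 r8_2).
Qed.

(** The converse of an order satisfies the same constraints as the order, so
    both possible comparisons of 1 and 2 are covered by [between_free18]. *)
Lemma ex_between18 (f : nat -> nat) :
    {in [pred v | 0 < v <= 18] &, injective f} ->
  exists x y, [/\ 0 < x < y, x + y <= 18
    & (f x < f y < f (x + y)) || (f (x + y) < f y < f x)].
Proof.
move=> f_inj.
have f_neq u v : 0 < u <= 18 -> 0 < v <= 18 -> u != v -> f u != f v.
  by move=> u18 v18; apply: contra => /eqP /(f_inj _ _ u18 v18) ->.
pose P (x y : nat) := [&& 0 < x < y, x + y <= 18
  & (f x < f y < f (x + y)) || (f (x + y) < f y < f x)].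
have [/existsP[x /existsP[y /and3P[]]] | /existsPn noP] :=
    boolP [exists x : 'I_18, exists y : 'I_18, P x y].
  by move=> *; exists x, y; split.
have free x y : 0 < x < y -> x + y <= 18 ->
    ~~ (f x < f y < f (x + y)) && ~~ (f (x + y) < f y < f x).
  move=> xy le18; have lt_x : x < 18 by lia.
  have lt_y : y < 18 by lia.
  have /existsPn/(_ (Ordinal lt_y)) := noP (Ordinal lt_x).
  by rewrite /P /= xy le18 /= negb_or.
pose r u v := f u < f v.
have not12 : ~~ (f 1 < f 2).
  apply: (@between_free18 r) => [u|v u w|u v u18 v18 nuv|//].
  - exact: ltnn.
  - exact: ltn_trans.
  - by rewrite /r -neq_ltn f_neq.
have not21 : ~~ (f 2 < f 1).
  apply: (@between_free18 (fun u v => r v u)) =>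
    [u|v u w ruv rvw|u v u18 v18 nuv|].
  - exact: ltnn.
  - exact: ltn_trans rvw ruv.
  - by rewrite /r -neq_ltn eq_sym f_neq.
  - by move=> x y xy le18; have := free x y xy le18; rewrite /r; lia.
by have := f_neq 1 2 isT isT isT; rewrite neq_ltn (negPf not12) (negPf not21).
Qed.

(** The factor k of the largest value k d, which is half the sum of the triple,
    is kept so that d can be recovered from the pair. *)
Lemma dilated_triple n (p : 'S_n) (d : nat) : 0 < d -> 18 * d <= n ->
  exists tk : 3.-tuple 'I_n * 'I_19,
    tk.1 \in additive_triples p /\
    (0 < tk.2) && (sumn (subseq_at p tk.1) == 2 * (tk.2 * d)).
Proof.
case: n p => [|n] p d_gt0 le_n; first by lia.
pose pos v : 'I_n.+1 := (p^-1)%g (inord (d * v).-1).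
have posK v : 0 < v <= 18 -> (p (pos v)).+1 = d * v.
  by move=> v18; rewrite permKV inordK; nia.
have [|x [y [xy le18 mono]]] := @ex_between18 (fun v => pos v : nat).
  move=> u v u18 v18 /val_inj Duv; have := posK v v18.
  by rewrite -Duv posK //; nia.
have x18 : 0 < x <= 18 by lia.
have y18 : 0 < y <= 18 by lia.
have z18 : 0 < x + y <= 18 by lia.
have lt19 : x + y < 19 by lia.
case/orP: mono => /andP[lt1 lt2].
  exists ([tuple pos x; pos y; pos (x + y)], Ordinal lt19).
  rewrite mem_additive_triples lt1 lt2 /subseq_at /= !posK //.
  by rewrite /schur_triple; split; nia.
exists ([tuple pos (x + y); pos y; pos x], Ordinal lt19).
rewrite mem_additive_triples lt1 lt2 /subseq_at /= !posK //.
by rewrite /schur_triple; split; nia.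
Qed.

Lemma card_additive_triples n (p : 'S_n) :
  n %/ 18 <= 19 * #|additive_triples p|.
Proof.
have ex_tk (d : 'I_(n %/ 18)) : exists tk : 3.-tuple 'I_n * 'I_19,
    tk.1 \in additive_triples p /\
    (0 < tk.2) && (sumn (subseq_at p tk.1) == 2 * (tk.2 * d.+1)).
  have le_n : 18 * d.+1 <= n by rewrite mulnC -leq_divRL.
  exact: (dilated_triple p (ltn0Sn d) le_n).
have [h hP] := fin_all_exists ex_tk.
have h_inj : injective h.
  move=> d e Dh; have [_ /andP[k_gt0 /eqP Dd]] := hP d.
  have [_ /andP[_ /eqP De]] := hP e; apply: val_inj => /=.
  by move: De; rewrite -Dh Dd; nia.
rewrite -[X in X <= _]card_ord -(card_imset _ h_inj).
rewrite mulnC -[X in _ * X]card_ord.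
rewrite -cardsT -cardsX; apply/subset_leq_card/subsetP=> _ /imsetP[d _ ->].
by rewrite !inE andbT; have [] := hP d; rewrite inE.
Qed.

Lemma G32_ge n : n %/ 18 <= 19 * G 3 2 n.
Proof. exact: card_additive_triples. Qed.

Import Order.TTheory GRing.Theory Num.Theory.

Local Open Scope ring_scope.

Theorem theorem5p6 (R : realType) :
  exists N : nat, forall n : nat, (N <= n)%N ->
    n%:R / (18 * (ln n%:R - ln 18 + 2)) - 6 <= (G 3 2 n)%:R :> R
    /\ (G 3 2 n)%:R <= 1 / 18 * n%:R ^+ 2 + 7 / 6 * n%:R :> R.
Proof.
(* This threshold is the one for which log n - log 18 + 2 >= 19. *)
pose B : R := sequences.expR (ln 18 + 17).
exists (Num.bound B).+1 => n le_Nn.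
have lt_Bn : B < n%:R.
  apply: lt_le_trans (archi_boundP (exp.expR_ge0 _)) _.
  by rewrite ler_nat ltnW.
have n_ge1 : 1 <= n%:R :> R by rewrite ler1n (leq_trans _ le_Nn).
split.
- have ln_ge : ln 18 + 17 <= ln n%:R :> R.
    rewrite -[leLHS]expRK ler_ln ?posrE ?expR_gt0 //; first exact: ltW.
    by apply: lt_le_trans n_ge1; lra.
  set L : R := ln n%:R - ln 18 + 2.
  have L_ge : 19 <= L by rewrite /L; lra.
  have lt_n : n%:R < 18 * (19 * (G 3 2 n)%:R + 1) :> R.
    have : (n < 18 * (19 * G 3 2 n + 1))%N.
      rewrite [ltnLHS](divn_eq n 18).
      by have := G32_ge n; have := ltn_pmod n (isT : 0 < 18)%N; lia.
    by rewrite -(ltr_nat R) natrM natrD natrM.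
  rewrite lerBlDr ler_pdivrMr; last by lra.
  have : 0 <= (G 3 2 n)%:R :> R by exact: ler0n.
  by nra.
- have upper : 4 * (G 3 2 n)%:R <= 2 * (n %/ 3)%:R ^+ 2 + 2 :> R.
    by rewrite -natrX -!natrM -natrD ler_nat G32_le.
  have le_m : 3 * (n %/ 3)%:R <= n%:R :> R.
    by rewrite -natrM ler_nat mulnC leq_divM.
  have : 0 <= (n %/ 3)%:R :> R by exact: ler0n.
  by nra.
Qed.
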